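(* For every infinite Tychonoff space $X$ and each nonzero countable ordinal $\alpha$, the function space $B_\alpha(X)$ does not have the Josefson--Nissenzweig property (JNP).
   Context: All locally convex spaces (lcs) are over the field $\mathbb{F}$ of real or complex numbers, Hausdorff and infinite-dimensional. $E'$ is the topological dual of $E$. A barrel in an lcs $E$ is a closed absorbent absolutely convex subset. A set $B\subseteq E$ is barrel-bounded if for every barrel $U\subseteq E$ there is $n\in\mathbb{N}$ with $B\subseteq nU$. The topology $\beta^*(E',E)$ on $E'$ is the locally convex topology of uniform convergence on barrel-bounded subsets of $E$: a neighborhood base at zero is given by the polars $B^\circ=\{\chi\in E': |\chi(x)|\le 1 \text{ for all } x\in B\}$ of barrel-bounded sets $B\subseteq E$. $E'_{w^*}$ is $E'$ with the weak$^*$ topology $\sigma(E',E)$ and $E'_{\beta^*}$ is $E'$ with $\beta^*(E',E)$. The space $E$ has the Josefson--Nissenzweig property (JNP) if the identity map $E'_{w^*}\to E'_{\beta^*}$ is not sequentially continuous; equivalently, there is a sequence in $E'$ converging to $0$ in $\sigma(E',E)$ but not in $\beta^*(E',E)$. For a Tychonoff space $X$, $B_0(X)=C_p(X)$ is the space of continuous functions $X\to\mathbb{F}$, and for every countable ordinal $\alpha\ge1$, $B_\alpha(X)$ is the family of all functions $f:X\to\mathbb{F}$ that are pointwise limits of sequences $\{f_n\}_{n\in\omega}\subseteq\bigcup_{\beta<\alpha}B_\beta(X)$. All spaces $B_\alpha(X)$ carry the topology of pointwise convergence inherited from the Tychonoff product $\mathbb{F}^X$. *)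

(* Defs.v *)
From HB Require Import structures.
From mathcomp Require Import all_boot all_order all_algebra.
From mathcomp Require Import all_classical all_reals all_analysis.
From mathcomp Require Import ring.

Set Implicit Arguments.
Unset Strict Implicit.
Unset Printing Implicit Defensive.

Import Order.TTheory GRing.Theory Num.Theory.
Import numFieldTopology.Exports.

Local Open Scope classical_set_scope.
Local Open Scope ring_scope.

Definition tychonoff_space (X : topologicalType) :=
  completely_regular_space X /\ hausdorff_space X.

Section barrels.
Context {K : numFieldType} {E : tvsType K}.
Implicit Types U B : set E.

Definition absorbent U :=
  forall x : E, exists2 r : K, 0 < r & forall a : K, `|a| <= r -> U (a *: x).

Definition balanced U :=
  forall (a : K) (x : E), `|a| <= 1 -> U x -> U (a *: x).

Definition absolutely_convex U := convex_set U /\ balanced U.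

Definition barrel U := [/\ closed U, absorbent U & absolutely_convex U].

Definition barrel_bounded B :=
  forall U, barrel U -> exists n : nat, B `<=` *:%R (n%:R : K) @` U.

End barrels.

Section dual.
Context {K : numFieldType} (E : tvsType K).

Definition dual : set (E -> K^o) :=
  [set chi : E -> K^o | linear chi /\ continuous chi].

(* A set coerces to the corresponding subtype, which carries the subspace
   topology; [{ptws _ -> _}] and [{family _, _ -> _}] are the topologies of
   pointwise convergence and of uniform convergence on the members of a
   family. *)
Definition weak_star_dual : topologicalType :=
  set_type (dual : set {ptws E -> K^o}).

Definition beta_star_dual : topologicalType :=
  set_type (dual : set {family @barrel_bounded K E, E -> K^o}).

End dual.

Section beta_star_polars.
Context {K : numFieldType} {E : tvsType K}.
Implicit Types U B : set E.

Let barrel_preimage_scale (k : K) U : k != 0 -> barrel U ->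
  barrel ( *:%R k @^-1` U).
Proof.
move=> k0 [clU absU [cvxU balU]]; split.
- apply: preimage_closed clU => x _; move: x.
  have ck : continuous ( *:%R k : E -> E).
    move=> x; have h : (k : K^o, z) @[z --> x] --> (k : K^o, x).
      exact: (cvg_pair (cvg_cst (k : K^o)) cvg_id).
    exact: cvg_comp h (@scale_continuous K E (k, x)).
  exact: ck.
- move=> x; have [r r0 rU] := absU (k *: x); exists r => // b br /=.
  by rewrite scalerA mulrC -scalerA; exact: rU.
- split=> [x y l|b x b1 /= Ux].
    rewrite !inE /= => Ux Uy.
    have := cvxU (k *: x) (k *: y) l; rewrite !inE => /(_ Ux Uy).
    congr U; rewrite /conv /= scalerDr !scalerA.
    by rewrite [l%:num * k]mulrC [_ * k in X in _ + X]mulrC.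
  by rewrite scalerA mulrC -scalerA; exact: balU.
Qed.

Lemma barrel_bounded_scale (k : K) B : k != 0 -> barrel_bounded B ->
  barrel_bounded ( *:%R k @` B).
Proof.
move=> k0 bB U /(barrel_preimage_scale k0)/bB[n nU]; exists n => _ [x Bx <-].
have [y Uy <-] := nU _ Bx; exists (k *: y) => //.
by rewrite !scalerA mulrC.
Qed.

Lemma barrel_bounded_setU B C : barrel_bounded B -> barrel_bounded C ->
  barrel_bounded (B `|` C).
Proof.
move=> bB bC U brU; have [m mU] := bB _ brU; have [n nU] := bC _ brU.
have [_ _ [_ balU]] := brU.
have incr (p q : nat) x : (p <= q)%N -> U x ->
    exists2 y, U y & (q%:R : K) *: y = (p%:R : K) *: x.
  move=> pq Ux; have [q0|q0] := posnP q.
    by move: pq; rewrite q0 leqn0 => /eqP ->; exists x.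
  have qn0 : (q%:R : K) != 0 by rewrite pnatr_eq0 -lt0n.
  exists ((p%:R / q%:R : K) *: x); last by rewrite scalerA mulrCA divff// mulr1.
  apply: balU => //; rewrite ger0_norm ?divr_ge0//.
  by rewrite ler_pdivrMr ?ltr0n// mul1r ler_nat.
exists (maxn m n) => x [/mU|/nU] [y Uy <-].
  by apply: incr Uy; exact: leq_maxl.
by apply: incr Uy; exact: leq_maxr.
Qed.

Lemma barrel_bounded_set0 : barrel_bounded (set0 : set E).
Proof. by move=> U _; exists 0%N => x []. Qed.

Definition polar B : set (E -> K^o) :=
  [set chi | dual chi /\ forall x, B x -> `|chi x| <= 1].

Let dualB (chi psi : E -> K^o) : dual chi -> dual psi -> dual (chi - psi).
Proof.
move=> [lchi cchi] [lpsi cpsi]; split=> [k x y|x].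
  change (chi (k *: x + y) - psi (k *: x + y) =
    k *: (chi x - psi x) + (chi y - psi y)).
  by rewrite lchi lpsi scalerBr opprD addrACA.
by apply: cvgB; [exact: cchi|exact: cpsi].
Qed.

Let beta_star_val : beta_star_dual E ->
  {family @barrel_bounded K E, E -> K^o} := val.

Let beta_star_val_continuous : continuous beta_star_val.
Proof. exact: (@initial_continuous _ _ set_val). Qed.

Lemma nbhs_beta_star_dualP (chi : beta_star_dual E)
    (A : set (beta_star_dual E)) :
  nbhs chi A <->
  exists2 B : set E, barrel_bounded B &
    [set psi : beta_star_dual E |
      polar B ((\val psi : E -> K^o) - (\val chi : E -> K^o))] `<=` A.
Proof.
split; last first.
  move=> [B bB BA]; apply: (filterS BA).
  have e1 : entourage [set uv : K^o * K^o | ball uv.1 1 uv.2].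
    by rewrite -entourage_ballE; exists 1 => //=.
  have /beta_star_val_continuous := @fam_nbhs _ _ _ B _ (beta_star_val chi) e1 bB.
  move=> nV; apply: (@filterS _ (nbhs chi) _ _ _ _ nV) => psi /= H; split.
    by apply: dualB; exact: set_valP.
  move=> x /H; rewrite -ball_normE /= distrC => /ltW; exact.
pose G := filter_from (@barrel_bounded K E) (fun B => [set psi : beta_star_dual E |
      polar B ((\val psi : E -> K^o) - (\val chi : E -> K^o))]).
have FG : Filter G.
  apply: filter_from_filter; first by exists set0; exact: barrel_bounded_set0.
  move=> B C bB bC; exists (B `|` C); first exact: barrel_bounded_setU.
  move=> psi [dpsi H]; split; split=> // x ?; apply: H; [by left|by right].
have : beta_star_val @ G --> beta_star_val chi.
  apply/fam_cvgP => B bB U /uniform_nbhs[V [+ VU]].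
  rewrite -entourage_ballE => -[e /= e0 eV].
  rewrite nbhs_filterE; apply: filterS VU _.
  have k0 : 2 / e != 0 by rewrite mulf_neq0 ?invr_eq0 ?gt_eqF.
  exists ( *:%R (2 / e) @` B); first exact: barrel_bounded_scale.
  move=> psi [[lin _] H] x Bx; apply: eV => /=.
  have /H : ( *:%R (2 / e) @` B) (2 / e *: x) by exists x.
  have -> : ((\val psi : E -> K^o) - (\val chi : E -> K^o)) (2 / e *: x) =
    (2 / e) * ((\val psi : E -> K^o) x - (\val chi : E -> K^o) x).
    set f := _ - _ in lin *.
    have f0 : f 0 = 0.
      by have := lin (- 1) 0 0; rewrite scaleN1r oppr0 add0r scaleN1r addNr.
    by have := lin (2 / e) x 0; rewrite addr0 f0 addr0.
  rewrite normrM gtr0_norm ?divr_gt0// mulrAC ler_pdivrMr// mul1r => ke.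
  rewrite -ball_normE /= distrC.
  rewrite -(ltr_pM2l (ltr0Sn K 1)); apply: le_lt_trans ke _.
  by rewrite ltr_pMl// ltr1n.
move=> cG [V [[V' oV' <-] V'chi] VA].
have /cG : nbhs (beta_star_val chi) V' by exact: open_nbhs_nbhs.
rewrite nbhs_filterE => -[B bB BV']; exists B => //.
by apply: subset_trans VA.
Qed.

End beta_star_polars.

Definition sequentially_continuous (S T : topologicalType) (f : S -> T) :=
  forall (u : nat -> S) (l : S), u @ \oo --> l -> f \o u @ \oo --> f l.

Definition JNP (K : numFieldType) (E : tvsType K) :=
  ~ sequentially_continuous (id : weak_star_dual E -> beta_star_dual E).

Section baire.
Context {d : Order.disp_t} {W : orderType d}.
Context (K : numFieldType) (X : topologicalType).

(* When [W] is well-ordered, an element [a] of [W] stands for the ordinal that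
   is the order type of [{b | b < a}]. Continuous functions are put in every
   class so that the classes are subspaces for any linear order [W]; the lemmas
   [baire_class_min] and [baire_class_gt_min] are the usual recursive
   equations. *)
Inductive baire_class : W -> set (X -> K^o) :=
| baire_class_continuous (a : W) (f : X -> K^o) :
    continuous f -> baire_class a f
| baire_class_limit (a : W) (f : X -> K^o)
      (b_ : nat -> W) (f_ : nat -> X -> K^o) :
    (forall n, (b_ n < a)%O) -> (forall n, baire_class (b_ n) (f_ n)) ->
    (forall x, f_ n x @[n --> \oo] --> f x) -> baire_class a f.

Lemma baire_class_min (a : W) : (forall b : W, (a <= b)%O) ->
  baire_class a = [set f : X -> K^o | continuous f].
Proof.
move=> amin; apply/seteqP; split=> f /=; last exact: baire_class_continuous.
move=> Bf; case: Bf amin => // {a}{}f a b_ f_ ba _ _ /(_ (b_ 0%N)).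
by rewrite leNgt ba.
Qed.

Lemma baire_class_gt_min (a : W) : (exists b : W, (b < a)%O) ->
  baire_class a = [set f : X -> K^o | exists2 f_ : nat -> X -> K^o,
    forall n, (\bigcup_(b in [set b | (b < a)%O]) baire_class b) (f_ n) &
    forall x, f_ n x @[n --> \oo] --> f x].
Proof.
move=> [b0 b0a]; apply/seteqP; split=> f /=.
  move=> Bf; case: Bf b0a => {a f} [a f cf b0a|a f b_ f_ ba Bf ff _].
    exists (fun=> f) => [n|x]; last exact: cvg_cst.
    by exists b0 => //; exact: baire_class_continuous.
  by exists f_ => // n; exists (b_ n) => //; exact: ba.
case=> f_ Bf ff.
have {}Bf n : exists b, (b < a)%O /\ baire_class b (f_ n).
  by have [b ba Bb] := Bf n; exists b.
have [b_ Hb] := choice Bf.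
by apply: (@baire_class_limit a f b_ f_) => // n; have [] := Hb n.
Qed.

Let baire_classZ (k : K) (a : W) (f : X -> K^o) :
  baire_class a f -> baire_class a (k *: f).
Proof.
elim=> {a f} [a f cf|a f b_ f_ ba _ IH ff].
  by apply: baire_class_continuous => x; apply: cvgZr; exact: cf.
apply: (baire_class_limit ba IH) => x; apply: cvgZr; exact: ff.
Qed.

Lemma baire_class_le (a b : W) (f : X -> K^o) : (a <= b)%O ->
  baire_class a f -> baire_class b f.
Proof.
rewrite le_eqVlt => /predU1P[->//|ab] Bf.
apply: (@baire_class_limit b f (fun=> a) (fun=> f)) => // x; exact: cvg_cst.
Qed.

Let baire_class_addl (a : W) (f g : X -> K^o) :
  continuous f -> baire_class a g -> baire_class a (f + g).
Proof.
move=> cf; elim=> {a g} [a g cg|a g b_ g_ ba _ IH gg].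
  by apply: baire_class_continuous => x; apply: cvgD; [exact: cf|exact: cg].
apply: (baire_class_limit ba IH) => x.
by apply: cvgD; [exact: cvg_cst|exact: gg].
Qed.

Let baire_class_addmax (a b : W) (f g : X -> K^o) :
  baire_class a f -> baire_class b g -> baire_class (Order.max a b) (f + g).
Proof.
move=> Bf; elim: Bf b g => {a f} [a f cf|a f a_ f_ aa Bf IHf ff] b g Bg.
  by apply: (@baire_class_le b); [rewrite le_max lexx orbT|
    exact: baire_class_addl].
case: Bg => {b g} [b g cg|b g b_ g_ bb Bg gg].
  apply: (@baire_class_le a); first by rewrite le_max lexx.
  by rewrite addrC; apply: baire_class_addl => //; exact: baire_class_limit ff.
apply: (@baire_class_limit _ _ (fun n => Order.max (a_ n) (b_ n))
  (fun n => f_ n + g_ n)) => [n|n|x].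
- by rewrite gt_max !lt_max aa bb orbT.
- exact: IHf.
- by apply: cvgD; [exact: ff|exact: gg].
Qed.

Definition baire_pred (a : W) : {pred X -> K^o} := mem (baire_class a).

Let baire_pred_submod_closed (a : W) : GRing.submod_closed (baire_pred a).
Proof.
split=> [|k f g]; rewrite !inE.
  by apply: baire_class_continuous => x; exact: cvg_cst.
move=> Bf Bg; rewrite -[a]maxxx; apply: baire_class_addmax => //.
exact: baire_classZ.
Qed.

HB.instance Definition _ (a : W) :=
  GRing.isSubmodClosed.Build K (X -> K^o) (baire_pred a)
    (baire_pred_submod_closed a).

Definition baire_space (a : W) : Type := {f : X -> K^o | baire_pred a f}.

End baire.

Section baire_tvs.
Context {d : Order.disp_t} {W : orderType d}.
Context (K : numFieldType) (X : topologicalType) (a : W).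
Local Notation B := (baire_space K X a).

HB.instance Definition _ := SubChoice.on B.
HB.instance Definition _ := [SubChoice_isSubLmodule of B by <:].
(* the topology induced by the product [K^X] *)
HB.instance Definition _ :=
  Uniform.copy B (set_type (baire_class a : set {ptws X -> K^o})).

Let val_ptws : B -> {ptws X -> K^o} := val.

Let val_ptws_continuous : continuous val_ptws.
Proof. exact: (@initial_continuous _ {ptws X -> K^o} set_val). Qed.

Lemma baire_space_cvgP (F : set_system B) (f : B) : Filter F ->
  F --> f <->
  forall x, (val g : X -> K^o) x @[g --> F] --> (val f : X -> K^o) x.
Proof.
move=> FF; split=> [Ff x|Ff U [V [[V' oV' <-] V'f] VU]].
  have : val_ptws @ F --> val_ptws f.
    exact: cvg_trans (cvg_app _ Ff) (@val_ptws_continuous f).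
  move/cvg_sup => /(_ x) h U Ux; apply: (h ((@^~ x) @^-1` U)).
  exact: (@initial_continuous _ _ (fun g : X -> K^o => g x)).
have : val_ptws @ F --> val_ptws f.
  apply/cvg_sup => x A [A0 [[A1 oA1 <-] A1f] AA].
  rewrite nbhs_filterE; apply: filterS AA _.
  by apply: Ff; exact: open_nbhs_nbhs.
move=> /(_ V') h; rewrite nbhs_filterE; apply: filterS VU _; apply: h.
exact: open_nbhs_nbhs.
Qed.

Let eval_continuous (x : X) : continuous (fun f : B => (val f : X -> K^o) x).
Proof. by move=> f; have /baire_space_cvgP := @cvg_id _ (nbhs f); apply. Qed.

Let add_continuous : continuous (fun x : B * B => x.1 + x.2).
Proof.
move=> [f g]; apply/baire_space_cvgP => x /=.
have f1 : (val z.1 : X -> K^o) x @[z --> (f, g)] --> (val f : X -> K^o) x.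
  exact: cvg_comp (@cvg_fst _ _ (nbhs f) (nbhs g) _) (@eval_continuous x f).
have g2 : (val z.2 : X -> K^o) x @[z --> (f, g)] --> (val g : X -> K^o) x.
  exact: cvg_comp (@cvg_snd _ _ (nbhs f) (nbhs g) _) (@eval_continuous x g).
exact: cvgD f1 g2.
Qed.

Let scale_continuous : continuous (fun z : K^o * B => z.1 *: z.2).
Proof.
move=> [k g]; apply/baire_space_cvgP => x /=.
have k1 : z.1 @[z --> (k, g)] --> k.
  exact: (@cvg_fst _ _ (nbhs k) (nbhs g)).
have g2 : (val z.2 : X -> K^o) x @[z --> (k, g)] --> (val g : X -> K^o) x.
  exact: cvg_comp (@cvg_snd _ _ (nbhs k) (nbhs g) _) (@eval_continuous x g).
exact: cvgZ k1 g2.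
Qed.

Let eval_ball_convex (x : X) (c e : K) :
  convex_set [set g : B | ball (c : K^o) e ((val g : X -> K^o) x)].
Proof.
apply/convex_setW => g h; rewrite !inE -!ball_normE /= => gx hx l l0 l1.
have l1' : 0 < 1 - l%:num by rewrite subr_gt0.
rewrite inE /=; set u := (val g : X -> K^o) x in gx *.
set v := (val h : X -> K^o) x in hx *.
have -> : c - (l%:num * u + (1 - l%:num) * v) =
    l%:num * (c - u) + (1 - l%:num) * (c - v) by ring.
rewrite (le_lt_trans (ler_normD _ _))// !normrM.
rewrite (gtr0_norm l0) (gtr0_norm l1').
have -> : e = l%:num * e + (1 - l%:num) * e by ring.
by rewrite ltrD// ltr_pM2l.
Qed.

Let convex_nbhs (f : B) (A : set B) : nbhs f A ->
  exists2 C : set B, [/\ open C, convex_set C & C f] & C `<=` A.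
Proof.
pose G := filter_from [set C : set B | [/\ open C, convex_set C & C f]] id.
have FG : Filter G.
  apply: filter_from_filter.
    by exists setT; split; [exact: openT|move=> *; rewrite inE|].
  move=> C D [oC cC Cf] [oD cD Df]; exists (C `&` D) => //; split=> //.
    exact: openI.
  move=> x y l; rewrite !in_setI => /andP[xC xD] /andP[yC yD].
  by rewrite cC// cD.
suff : G --> f by move=> /(_ A) GA /GA.
apply/baire_space_cvgP => x U; rewrite -nbhs_ballE => -[e e0 eU].
exists [set g : B | ball ((val f : X -> K^o) x) e ((val g : X -> K^o) x)].
  split; [|exact: eval_ball_convex|exact: ballxx].
  apply: open_comp; [move=> ? _; exact: eval_continuous|].
  exact: (@ball_open _ K^o).
by move=> g /eU.
Qed.

Let locally_convex :
  exists2 C : set_system B, (forall b, b \in C -> convex_set b) & basis C.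
Proof.
exists [set C : set B | open C /\ convex_set C].
  by move=> b; rewrite inE => -[].
split=> [b []//|f A /convex_nbhs[C [oC cC Cf] CA]].
by exists C.
Qed.

HB.instance Definition _ :=
  PreTopologicalNmodule_isTopologicalNmodule.Build B add_continuous.
HB.instance Definition _ :=
  TopologicalNmodule_isTopologicalLmodule.Build K B scale_continuous.
HB.instance Definition _ := Uniform_isTvs.Build K B locally_convex.

Lemma baire_space_hausdorff : hausdorff_space B.
Proof.
move=> f g fg; apply/val_inj/funext => x.
apply: (@norm_hausdorff K K^o) => U V fU gV.
have [h [Uh Vh]] := fg _ _ (eval_continuous fU) (eval_continuous gV).
by exists ((val h : X -> K^o) x).
Qed.

End baire_tvs.

(* Main.v *)
(* A functional in the dual of [B_alpha(X)] is a finite linear combination of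
   evaluations. Let [chi n] be weak* null with finite supports [s n]. If the
   union [D] of the supports were infinite, choose points [z j] of [D] with
   pairwise disjoint neighbourhoods. Products of continuous functions decrease to
   functions [g j] vanishing outside these neighbourhoods, equal to 1 at [z j] and
   to 0 at all other points of [D]; so every sum of the [c j * g j] is of Baire
   class 1, and a gliding-hump choice of [c] makes infinitely many of the [chi n]
   take the value 1 at it. Hence [D] is finite, the coefficients of [chi n] tend
   to 0, and the convergence is uniform on barrel-bounded sets because these are
   pointwise bounded: [{f | `|f x| <= 1}] is a barrel. *)
Require Import Defs.
From HB Require Import structures.
From mathcomp Require Import all_boot all_order all_algebra.
From mathcomp Require Import all_classical all_reals all_analysis.
From mathcomp Require Import wochoice complex lra.

Import Order.TTheory GRing.Theory Num.Theory.
Import numFieldTopology.Exports.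

Local Open Scope classical_set_scope.
Local Open Scope ring_scope.
Local Open Scope complex_scope.

(** * Recursion, finite sums and the gliding hump *)

Lemma strong_recursion (T : Type) (t0 : T) (F : nat -> (nat -> T) -> T) :
  exists c : nat -> T,
    forall l, c l = F l (fun i => if (i < l)%N then c i else t0).
Proof.
(* [g n] tabulates the first [n] values and is [t0] from [n] on, so the value at [l] is read from
   [g l.+1]. *)
pose fix g n : nat -> T := if n is m.+1
  then fun i => if i == m then F m (g m) else g m i else fun=> t0.
have gE n i : g n i = if (i < n)%N then g i.+1 i else t0.
  elim: n i => [//|n IH] i /=; rewrite eqxx ltnS leq_eqVlt.
  have [->//|ni] := eqVneq i n; rewrite IH /= eqxx //.
exists (fun l => g l.+1 l) => l /=; rewrite eqxx; congr F.
by apply/funext => i; rewrite gE /= eqxx.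
Qed.

(** Both sums reduce to the entries common to [s] and [t]. *)
Lemma big_supp (K : pzRingType) (I : eqType) (F : I -> K) (s t : seq I) :
  uniq s -> uniq t ->
  (forall x, x \in s -> x \notin t -> F x = 0) ->
  (forall x, x \in t -> x \notin s -> F x = 0) ->
  \sum_(x <- s) F x = \sum_(x <- t) F x.
Proof.
move=> us ut Fs Ft.
have restrict (p q : seq I) : (forall x, x \in p -> x \notin q -> F x = 0) ->
    \sum_(x <- p) F x = \sum_(x <- [seq x <- p | x \in q]) F x.
  move=> H; rewrite (bigID (mem q)) /= [X in _ + X]big1_seq ?addr0 ?big_filter//.
  by move=> x /andP[xq xp]; exact: H.
rewrite (restrict s t)// (restrict t s)//; apply: perm_big.
apply: uniq_perm; rewrite ?filter_uniq// => x; rewrite !mem_filter.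
by rewrite andbC.
Qed.

(* Gliding hump: if there is a row whose last nonzero entry is in column [l],
   one of them, [r l], is selected, and [c l] is defined recursively so that the
   pairing of this row with [c] is 1. *)
Lemma null_finite_rows_zero_column (K : numFieldType) (a : nat -> nat -> K)
    (b : nat -> nat) :
  (forall n j, (b n <= j)%N -> a n j = 0) ->
  (forall c : nat -> K,
    (\sum_(j < b n) a n j * c j : K^o) @[n --> \oo] --> (0 : K^o)) ->
  exists j, forall n, a n j = 0.
Proof.
move=> ab null; apply: contrapT => /forallNP nz.
have {}nz j : exists n, a n j != 0.
  have /existsNP[n /eqP an] := nz j; by exists n.
pose last_nz l n := a n l != 0 /\ forall i, (l < i)%N -> a n i = 0.
pose r l := get (last_nz l).
(* [c l] solves the equation saying that row [r l] pairs to 1 with [c]. Where no row ends in column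
   [l], [r l] is a default value and [c l] may be anything. *)
have [c cE] := @strong_recursion K 0 (fun l c =>
  (1 - \sum_(i < l) a (r l) i * c i) / a (r l) l).
have sum1 l n : last_nz l n -> \sum_(j < b (r l)) a (r l) j * c j = 1.
  move=> nl; have [rl0 rlt] : last_nz l (r l) by apply: getPex; exists n.
  have lb : (l < b (r l))%N.
    by rewrite ltnNge; apply/negP => /ab; exact/eqP.
  rewrite -(subnKC lb) big_split_ord/= [X in _ + X]big1 ?addr0; last first.
    by move=> i _; rewrite rlt ?mul0r//= addSn ltnS leq_addr.
  rewrite big_ord_recr/= [c l]cE.
  under [X in 1 - X]eq_bigr do rewrite ltn_ord.
  by rewrite mulrC divfK// addrC subrK.
have /cvgr0_norm_lt/(_ _ ltr01) [N _ small] := null c.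
(* Rows before [N] vanish from column [j0] on, so a row with a nonzero entry there has index at
   least [N]. *)
pose j0 := \max_(n < N) b n.
have [n nj0] := nz j0.
have exl : exists l, (fun l => (j0 <= l)%N && (a n l != 0)) l.
  by exists j0; rewrite leqnn.
have lbd l : (j0 <= l)%N && (a n l != 0) -> (l <= b n)%N.
  by move=> /andP[_]; apply: contraNT; rewrite -ltnNge => /ltnW /ab ->.
have [l /andP[j0l anl] lmax] := ex_maxnP exl lbd.
have nl : last_nz l n.
  split=> // i li; apply/eqP/negPn/negP => ani.
  by have := li; rewrite ltnNge lmax// ani andbT (leq_trans j0l)// ltnW.
(* The selected row [r l] may differ from [n], but it too ends in column [l >= j0]; so its index is
   at least [N], although its pairing with [c] is 1. *)
have [rl0 _] : last_nz l (r l) by apply: getPex; exists n.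
have Nr : (N <= r l)%N.
  rewrite leqNgt; apply: contra_neqN rl0 => rN; apply: ab.
  by apply: leq_trans j0l; exact: (leq_bigmax (Ordinal rN)).
by have := small _ Nr; rewrite /= (sum1 l n)// normr1 ltxx.
Qed.

(** * Separation in Tychonoff spaces *)

Section separation.
Context (R : realType) (X : topologicalType).
Hypothesis tychX : tychonoff_space X.

Lemma tychonoff_bump (U : set X) (x : X) : open U -> U x ->
  exists f : X -> R, [/\ continuous f, forall y, 0 <= f y <= 1, f x = 1 &
    forall y, ~ U y -> f y = 0].
Proof.
move=> oU Ux; have [crX _] := tychX.
have clU : closed (~` U) by rewrite closedC.
have /(@uniform_separatorP _ R)[f [cf f01 f0 f1]] := crX x _ clU (fun h => h Ux).
exists (fun y => 1 - f y); split=> [y|y||y Uy].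
- by apply: (@cvgB R R^o); [exact: cvg_cst|exact: cf].
- have : `[0%R, 1%R]%classic (f y) by apply: f01; exists y.
  by rewrite /= in_itv/= subr_ge0 lerBlDr lerDl andbC.
- by rewrite (f0 (f x)) ?subr0//; exists x.
- by rewrite (f1 (f y)) ?subrr//; exists y.
Qed.

Lemma tychonoff_sep_pt (x y : X) : x != y ->
  exists f : X -> R, [/\ continuous f, forall z, 0 <= f z <= 1, f x = 1 &
    f y = 0].
Proof.
move=> xy; have [_ hX] := tychX.
have oy : open (~` [set y]).
  by rewrite openC; exact/accessible_closed_set1/hausdorff_accessible.
have [f [cf f01 fx fy]] := @tychonoff_bump _ x oy (fun h => negP xy (introT eqP h)).
by exists f; split=> //; apply: fy => /(_ erefl).
Qed.

Lemma tychonoff_sep_seq (x : X) (s : seq X) :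
  exists f : X -> R, [/\ continuous f, forall z, 0 <= f z <= 1, f x = 1 &
    forall y, y \in s -> y != x -> f y = 0].
Proof.
elim: s => [|y s [f [cf f01 fx fs]]].
  by exists (fun=> 1); split=> // [z|z]; [exact: cvg_cst|rewrite ler01 lexx].
have [->|yx] := eqVneq y x.
  exists f; split=> // z; rewrite inE => /predU1P[->|]; last exact: fs.
  by rewrite eqxx.
have [|g [cg g01 gx gy]] := @tychonoff_sep_pt x y; first by rewrite eq_sym.
exists (fun z => f z * g z); split=> [z|z||z].
- by apply: cvgM; [exact: cf|exact: cg].
- have [/andP[f0 f1] /andP[g0 g1]] := (f01 z, g01 z).
  by rewrite mulr_ge0//= mulr_ile1.
- by rewrite fx gx mulr1.
- rewrite inE => /predU1P[->|zs zx]; first by rewrite gy mulr0.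
  by rewrite fs ?mul0r.
Qed.

(** Points are split off one at a time: inside an open set meeting [D] in an infinite set, a point
    of [D] gets a neighbourhood disjoint from a smaller open set that still meets [D] in an infinite
    set. *)
Lemma infinite_disjoint_nbhs (D : set X) : infinite_set D ->
  exists (z : nat -> X) (U : nat -> set X),
    [/\ forall j, D (z j), forall j, open (U j), forall j, U j (z j) &
      forall i j x, U i x -> U j x -> i = j].
Proof.
move=> infD; pose P (V : set X) := open V /\ infinite_set (V `&` D).
have opre (f : X -> R) (A : set R) : continuous f -> open A ->
    open (f @^-1` A).
  by move=> cf oA; apply: open_comp => // y _; exact: cf.
have step (V : set X) : P V -> exists w : (X * set X) * set X,
    [/\ D w.1.1, w.1.2 w.1.1, open w.1.2 /\ w.1.2 `<=` V, P w.2 &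
      w.2 `<=` V /\ w.1.2 `&` w.2 = set0].
  move=> [oV infV].
  have split_off (p : X) (h : X -> R) : continuous h -> V p -> D p ->
      h p = 1 -> infinite_set ((V `&` h @^-1` [set r | r < 2 / 3]) `&` D) ->
      exists w : (X * set X) * set X,
        [/\ D w.1.1, w.1.2 w.1.1, open w.1.2 /\ w.1.2 `<=` V, P w.2 &
          w.2 `<=` V /\ w.1.2 `&` w.2 = set0].
    move=> ch Vp Dp hp infh.
    exists ((p, V `&` h @^-1` [set r | 2 / 3 < r]), V `&` h @^-1` [set r | r < 2 / 3]).
    split=> //=.
    - by split=> //; rewrite /= hp; lra.
    - by split; [apply: openI => //; apply: opre => //; exact: open_gt|move=> ? []].
    - by split=> //; apply: openI => //; apply: opre => //; exact: open_lt.
    - split; first by move=> ? [].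
      rewrite -subset0 => y [[_ /= h1] [_ /= h2]]; lra.
  (* With [f b = 1] and [f a = 0], the sets where [f < 2 / 3] and where [1 - f < 2 / 3] cover the
     space, as the threshold exceeds 1/2. One of them has infinite trace on [V] and [D]; in the
     first case [b] is split off, in the second [a]. *)
  have [a [Va Da]] := infinite_setN0 infV.
  have [b [[Vb Db] /= /eqP ba]] :=
    infinite_setN0 (infinite_setD infV (finite_set1 a)).
  have [f [cf _ fb fa]] := tychonoff_sep_pt _ _ ba.
  have [|fin1] := pselect (infinite_set ((V `&` f @^-1` [set r | r < 2 / 3]) `&` D)).
    exact: (split_off b f).
  apply: (split_off a (fun x => 1 - f x)) => //; last 1 first.
  - move=> fin2; apply: infV; move/contrapT : fin1 => fin1.
    have := conj fin1 fin2; rewrite -finite_setU; apply: sub_finite_set.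
    move=> y [Vy Dy]; have [h|h] := ltP (f y) (2 / 3); [left|right];
      by split=> //; split=> //; rewrite /=; lra.
  - by move=> y; apply: (@cvgB R R^o); [exact: cvg_cst|exact: cf].
  - by rewrite fa subr0.
pose S := {V : set X | P V}.
have P0 : P setT by split; [exact: openT|rewrite setTI].
have [nxt nxtP] := choice (fun V : S => step (sval V) (svalP V)).
have Pnxt (V : S) : P (nxt V).2 by have [] := nxtP V.
pose st n : S := iter n (fun V => exist P _ (Pnxt V)) (exist P _ P0).
have st_dec m n : (m <= n)%N -> sval (st n) `<=` sval (st m).
  move=> /subnK <-; elim: (n - m)%N => // k IH; rewrite addSn.
  apply: subset_trans IH; rewrite /st iterS -/(st (k + m)%N) /=.
  by have [_ _ _ _ []] := nxtP (st (k + m)%N).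
exists (fun j => (nxt (st j)).1.1), (fun j => (nxt (st j)).1.2).
(* The later neighbourhood lies in stage [j], hence in stage [i.+1], which is disjoint from the
   neighbourhood chosen at stage [i]. *)
have disj i j x : (i < j)%N -> (nxt (st i)).1.2 x -> ~ (nxt (st j)).1.2 x.
  move=> ij xi xj; have [_ _ _ _ [_ /seteqP[+ _]]] := nxtP (st i).
  move=> /(_ x); apply; split=> //; have [_ _ [_ sub] _ _] := nxtP (st j).
  exact: (st_dec i.+1 j ij) (sub _ xj).
split=> [j|j|j|i j x xi xj]; try by have [? ? [? _]] := nxtP (st j).
by have [/disj/(_ xi)|/disj/(_ xj)|] := ltgtP i j.
Qed.

End separation.

(** * Interpolation by functions of Baire class 1 *)

(* [iota] stands for the embedding of the reals in [R] or [R[i]]. *)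
Section baire_one.
Context (R : realType) (X : topologicalType).
Hypothesis tychX : tychonoff_space X.
Context (K : numFieldType) (iota : R -> K^o).
Hypotheses (iota_continuous : continuous iota)
  (iota0 : iota 0 = 0) (iota1 : iota 1 = 1).

(** A substitute for the indicator function of [z], which need not be of Baire class 1: only the
    countably many points listed by [s] are separated from [z]. The approximants themselves vanish
    off [U], so that they can be summed over disjoint sets. *)
Lemma baire_one_indicator (U : set X) (z : X) (s : nat -> seq X) :
  open U -> U z ->
  exists (g_ : nat -> X -> R) (g : X -> R),
    [/\ forall n, continuous (g_ n),
      forall x, g_ n x @[n --> \oo] --> g x, g z = 1,
      forall n x, ~ U x -> g_ n x = 0 &
      forall m x, x \in s m -> x != z -> g x = 0].
Proof.
move=> oU Uz; have [q [cq q01 qz qU]] := @tychonoff_bump R X tychX U z oU Uz.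
have [h hP] := choice (fun m => @tychonoff_sep_seq R X tychX z (s m)).
pose g_ n x := q x * \prod_(m < n) h m x.
have g_ge0 n x : 0 <= g_ n x.
  have [/andP[q0 _]] := q01 x; apply: mulr_ge0 => //; apply: prodr_ge0 => m _.
  by have [_ /(_ x)/andP[]] := hP m.
have g_S n x : g_ n.+1 x = g_ n x * h n x by rewrite /g_ big_ord_recr mulrA.
have g_dec x : {homo (g_ ^~ x) : n m / (n <= m)%N >-> m <= n}.
  apply/nonincreasing_seqP => n; rewrite g_S ler_piMr//.
  by have [_ /(_ x)/andP[]] := hP n.
have cvg_g x : cvgn (g_ ^~ x).
  apply: nonincreasing_is_cvgn; first exact: g_dec.
  by exists 0 => _ [n _ <-].
exists g_, (fun x => limn (g_ ^~ x)); split => //.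
- elim=> [|n IH] x.
    have -> : g_ 0%N = q by apply/funext => y; rewrite /g_ big_ord0 mulr1.
    exact: cq.
  have -> : g_ n.+1 = (fun y => g_ n y * h n y) by apply/funext => y.
  by apply: cvgM; [exact: IH|have [ch _ _ _] := hP n; exact: ch].
- have -> : g_ ^~ z = fun=> 1.
    apply/funext => n; rewrite /g_ qz mul1r big1// => m _.
    by have [_ _ -> _] := hP m.
  exact: lim_cst.
- by move=> n x Ux; rewrite /g_ qU ?mul0r.
(* The factor [h m] enters at index [m.+1] and makes the product 0 at [x]; monotonicity bounds the
   limit by this value. *)
- move=> m x xs xz; apply/eqP; rewrite eq_le; apply/andP; split.
    have -> : 0 = g_ m.+1 x.
      by rewrite g_S; have [_ _ _ ->] := hP m; rewrite ?mulr0.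
    exact: nonincreasing_cvgn_ge.
  by apply: limr_ge => //; near=> n.
Unshelve. all: by end_near. Qed.

(** At each point at most one summand is nonzero, so the series converges pointwise however fast [c]
    grows. *)
Lemma baire_one_interpolation (z : nat -> X) (U : nat -> set X)
    (s : nat -> seq X) (c : nat -> K) :
  (forall j, open (U j)) -> (forall j, U j (z j)) ->
  (forall i j x, U i x -> U j x -> i = j) ->
  exists (f_ : nat -> X -> K^o) (f : X -> K^o),
    [/\ forall n, continuous (f_ n),
      forall x, f_ n x @[n --> \oo] --> f x, forall j, f (z j) = c j &
      forall m x, x \in s m -> (forall j, x != z j) -> f x = 0].
Proof.
move=> oU Uz disjU.
have [g_ /choice[g gP]] :=
  choice (fun j => @baire_one_indicator (U j) (z j) s (oU j) (Uz j)).
(* The index [n] both truncates the series and selects the approximants, so each [f_ n] is a finite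
   sum of continuous functions. *)
pose f_ n x : K^o := \sum_(j < n) c j * iota (g_ j n x).
have f_E j n x : U j x -> (j < n)%N -> f_ n x = c j * iota (g_ j n x).
  move=> Ux jn; rewrite /f_ (bigD1 (Ordinal jn))//= big1 ?addr0// => i ij.
  have [_ _ _ gU _] := gP i; rewrite gU ?iota0 ?mulr0// => Uix.
  by move: ij; rewrite -val_eqE/= (disjU _ _ _ Uix Ux) eqxx.
have iota_g j x : c j * iota (g_ j n x) @[n --> \oo] --> c j * iota (g j x).
  apply: cvgM; first exact: cvg_cst.
  have [_ cg _ _ _] := gP j.
  by apply: (cvg_comp _ iota (cg x)); exact: iota_continuous.
have lim_f x : exists l : K^o, [/\ f_ n x @[n --> \oo] --> l,
    forall j, U j x -> l = c j * iota (g j x) &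
    (forall j, ~ U j x) -> l = 0].
  have [[j Ujx]|noU] := pselect (exists j, U j x).
    exists (c j * iota (g j x)); split=> [|i Uix|/(_ j)//].
      apply: cvg_trans (iota_g j x); apply: near_eq_cvg.
      by exists j.+1 => // n /= jn; rewrite (f_E j).
    by rewrite (disjU _ _ _ Ujx Uix).
  have {}noU j : ~ U j x by move=> Ujx; apply: noU; exists j.
  exists 0; split=> // [|j /noU//].
  have -> : f_ ^~ x = fun=> 0.
    apply/funext => n; rewrite /f_ big1// => j _.
    by have [_ _ _ gU _] := gP j; rewrite gU// iota0 mulr0.
  exact: cvg_cst.
have [f fP] := choice lim_f; exists f_, f; split.
- move=> n; apply: (continuous_big (@add_continuous K^o)) => j _ x.
  apply: cvgM; first exact: cvg_cst.
  have [cg _ _ _ _] := gP j.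
  by apply: (cvg_comp _ iota (cg n x)); exact: iota_continuous.
- by move=> x; have [] := fP x.
- move=> j; have [_ /(_ j (Uz j)) -> _] := fP (z j).
  by have [_ _ -> _ _] := gP j; rewrite iota1 mulr1.
- move=> m x xs xz; have [_ fU f0] := fP x.
  have [[j Ujx]|noU] := pselect (exists j, U j x); last first.
    by apply: f0 => j Ujx; apply: noU; exists j.
  rewrite (fU j)//; have [_ _ _ _ gs] := gP j.
  by rewrite (gs m x xs)// iota0 mulr0.
Qed.

(** Pairing with [e] reads off the coefficient at [x] of a combination of evaluations at distinct
    points of [s]. *)
Lemma tychonoff_dual_basis (x : X) (s : seq X) :
  exists e : X -> K^o, continuous e /\ forall y, y \in s -> e y = (y == x)%:R.
Proof.
have [f [cf _ fx fs]] := @tychonoff_sep_seq R X tychX x s.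
exists (iota \o f); split=> [y|y ys] /=.
  by apply: (cvg_comp _ iota (cf y)); exact: iota_continuous.
by have [->|/(fs _ ys) ->] := eqVneq y x; rewrite ?fx.
Qed.

End baire_one.

(** * Functionals and barrel-bounded sets *)

Lemma closed_norm_le (K : numFieldType) (r : K) :
  0 <= r -> closed [set y : K^o | `|y| <= r].
Proof.
(* The order of [K] may be partial, as for [R[i]], but norms and [r] are real and hence
   comparable. *)
move=> r0 x clx; rewrite /= real_leNgt ?normr_real ?ger0_real//.
apply/negP => rx; have rx0 : 0 < `|x| - r by rewrite subr_gt0.
have [y /= [yr]] := clx _ (nbhsx_ballx x _ rx0).
rewrite -ball_normE /= => xy; have := ler_normD (x - y) y.
rewrite subrK => /le_lt_trans/(_ (ltr_leD xy yr)).
by rewrite subrK ltxx.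
Qed.

Section baire_space_dual.
Context (R : realType) (X : topologicalType).
Hypothesis tychX : tychonoff_space X.
Context (K : numFieldType) (iota : R -> K^o).
Hypotheses (iota_continuous : continuous iota)
  (iota0 : iota 0 = 0) (iota1 : iota 1 = 1).
Context (d : Order.disp_t) (W : orderType d) (alpha : W).
Local Notation E := (baire_space K X alpha).
Local Notation ev f x := ((val (f : E) : X -> K^o) x).

Lemma baire_space_eval_continuous (x : X) : continuous (fun f : E => ev f x).
Proof. by move=> f; have /baire_space_cvgP := @cvg_id _ (nbhs f); apply. Qed.

(** Continuity at 0 gives a finite [s] such that [chi] has norm below 1 on the subspace of functions
    vanishing on [s]; by scaling, it is 0 there. *)
Lemma dual_vanish (chi : E -> K^o) : dual chi ->
  exists s : seq X, forall f : E, (forall x, x \in s -> ev f x = 0) ->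
    chi f = 0.
Proof.
move=> [lin cchi]; pose L : {linear E -> K^o} :=
  HB.pack chi (GRing.isLinear.Build _ _ _ _ chi lin).
(* The filter of the subspaces [{f | f = 0 on s}], [s] finite, converges to 0. *)
pose G := filter_from [set: seq X]
  (fun s => [set f : E | forall x, x \in s -> ev f x = 0]).
have FG : Filter G.
  apply: filter_from_filter; first by exists [::].
  move=> s t _ _; exists (s ++ t) => // f fst; split=> x xs; apply: fst;
    by rewrite mem_cat xs ?orbT.
have G0 : G --> (0 : E).
  apply/baire_space_cvgP => x V V0; exists [:: x] => // f /= /(_ x).
  by rewrite mem_head => /(_ isT) ->; exact: nbhs_singleton V0.
have chi0 : chi 0 = 0 by exact: (raddf0 L).
have [|s _ sV] := G0 (chi @^-1` [set y : K^o | `|y| < 1]).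
  apply: cchi; rewrite chi0.
  exists 1 => /=; first exact: ltr01.
  by move=> y /=; rewrite sub0r normrN.
exists s => f fs; apply/eqP/negPn/negP => chif.
have /sV /= : forall x, x \in s -> ev ((chi f)^-1 *: f) x = 0.
  by move=> x /fs fx; change ((chi f)^-1 * ev f x = 0); rewrite fx mulr0.
have -> : chi ((chi f)^-1 *: f) = (chi f)^-1 * chi f by exact: (linearZ_LR L).
by rewrite mulVf// normr1 ltxx.
Qed.

(** Subtracting from [f] its interpolant on a finite set leaves a function killed by [chi], by
    [dual_vanish]. *)
Lemma baire_space_dualE (chi : E -> K^o) : dual chi ->
  exists (s : seq X) (a : X -> K), [/\ uniq s,
    forall x, (x \in s) = (a x != 0) &
    forall f : E, chi f = \sum_(x <- s) a x * ev f x].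
Proof.
move=> dchi; have [s0 chi_s0] := dual_vanish _ dchi; have [lin _] := dchi.
pose L : {linear E -> K^o} :=
  HB.pack chi (GRing.isLinear.Build _ _ _ _ chi lin).
pose s := undup s0.
have /choice[e eP] x : exists e : E, forall y, y \in s -> ev e y = (y == x)%:R.
  have [f [cf fs]] :=
    tychonoff_dual_basis R X tychX K iota iota_continuous iota0 iota1 x s.
  by exists (exist _ f (mem_set (baire_class_continuous alpha cf))).
have chiE (f : E) : chi f = \sum_(x <- s) chi (e x) * ev f x.
  pose h : E := \sum_(x <- s) ev f x *: e x.
  have -> : chi f = chi h.
    apply/eqP; rewrite -subr_eq0 -(raddfB L); apply/eqP; apply: chi_s0 => y ys.
    change (ev f y - ev h y = 0); rewrite /h raddf_sum fct_sumE.
    rewrite (bigD1_seq y) ?undup_uniq ?mem_undup//= big1_seq => [|x /andP[xy xs]].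
      change (ev f y - (ev f y * ev (e y) y + 0) = 0).
      by rewrite eP ?mem_undup// eqxx mulr1 addr0 subrr.
    change (ev f x * ev (e x) y = 0).
    by rewrite eP ?mem_undup// eq_sym (negPf xy) mulr0.
  rewrite -[LHS]/(L h) /h raddf_sum; apply: eq_bigr => x _.
  by rewrite mulrC; exact: (linearZ_LR L).
(* Coefficients are set to 0 off [s], and zero coefficients are then filtered out, so that the list
   is exactly the support. *)
pose a x := if x \in s then chi (e x) : K else 0.
exists [seq x <- s | a x != 0], a; split.
- by rewrite filter_uniq// undup_uniq.
- move=> x; rewrite mem_filter andb_idr// /a.
  by case: ifP => // _; rewrite eqxx.
- move=> f; rewrite chiE big_filter [RHS]big_mkcond/= !big_seq.
  apply: eq_bigr => x xs; rewrite /a xs.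
  by case: eqVneq => [->|//]; rewrite mul0r.
Qed.

Lemma barrel_bounded_eval (B : set E) : barrel_bounded B ->
  exists M : X -> K, forall x (f : E), B f -> `|ev f x| <= M x.
Proof.
move=> bB; suff /choice[M MP] x : exists m : K, forall f : E, B f -> `|ev f x| <= m.
  by exists M.
have [|n BU] := bB [set f : E | `|ev f x| <= 1].
  split.
  - apply: (@preimage_closed _ _ _ [set y : K^o | `|y| <= 1]).
      by move=> f _; exact: baire_space_eval_continuous.
    exact: closed_norm_le.
  (* Adding 1 keeps the radius defined when [f] vanishes at [x]. *)
  - move=> f; exists (1 + `|ev f x|)^-1; first by rewrite invr_gt0 ltr_pwDl.
    move=> b bf; change (`|b * ev f x| <= 1); rewrite normrM.
    apply: le_trans (ler_wpM2r (normr_ge0 _) bf) _.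
    by rewrite ler_pdivrMl ?ltr_pwDl// mulr1 lerDr.
  - split.
      apply/convex_setW => f g; rewrite !inE /= => fx gx l l0 l1.
      rewrite inE /=.
      change (`|l%:num * ev f x + (1 - l%:num) * ev g x| <= 1).
      rewrite (le_trans (ler_normD _ _))// !normrM gtr0_norm//.
      have l1' : 0 < 1 - l%:num by rewrite subr_gt0.
      rewrite (gtr0_norm l1') -[leRHS](subrKC l%:num).
      by rewrite lerD// ler_piMr// ltW.
    move=> b f b1 /= fx; change (`|b * ev f x| <= 1).
    by rewrite normrM mulr_ile1.
exists n%:R => f /BU[g gx <-]; change (`|n%:R * ev g x| <= n%:R).
by rewrite normrM normr_nat ler_piMr.
Qed.

End baire_space_dual.

(** * Weak* convergence *)

Section weak_star.
Context (K : numFieldType) (E : tvsType K).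

Lemma dual_sub (chi psi : E -> K^o) : dual chi -> dual psi -> dual (chi - psi).
Proof.
move=> [lchi cchi] [lpsi cpsi]; split=> [k x y|x].
  change (chi (k *: x + y) - psi (k *: x + y) =
    k *: (chi x - psi x) + (chi y - psi y)).
  by rewrite lchi lpsi scalerBr opprD addrACA.
by apply: cvgB; [exact: cchi|exact: cpsi].
Qed.

Lemma weak_star_dual_cvg (u : nat -> weak_star_dual E) (l : weak_star_dual E) :
  u @ \oo --> l ->
  forall x, (\val (u n) : E -> K^o) x @[n --> \oo] --> (\val l : E -> K^o) x.
Proof.
pose v : weak_star_dual E -> {ptws E -> K^o} := val.
have cv : continuous v by exact: (@initial_continuous _ {ptws E -> K^o} set_val).
move=> ul x; have /cvg_sup/(_ x) h : v \o u @ \oo --> v l.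
  exact: cvg_trans (cvg_app v ul) (cv l).
move=> U Ux; apply: (h ((@^~ x) @^-1` U)).
exact: (@initial_continuous _ _ (fun g : E -> K^o => g x)).
Qed.

End weak_star.

(** * Weak* null sequences converge uniformly on barrel-bounded sets *)

Section baire_space_not_JNP.
Context (R : realType) (X : topologicalType).
Hypothesis tychX : tychonoff_space X.
Context (K : numFieldType) (iota : R -> K^o).
Hypotheses (iota_continuous : continuous iota)
  (iota0 : iota 0 = 0) (iota1 : iota 1 = 1).
Context (d : Order.disp_t) (W : orderType d) (alpha : W).
Hypothesis alpha_gt0 : exists beta : W, (beta < alpha)%O.
Local Notation E := (baire_space K X alpha).
Local Notation ev f x := ((val (f : E) : X -> K^o) x).

(** Otherwise the matrix [a n (z j)], for points [z j] with disjoint neighbourhoods, would have a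
    zero column, although every [z j] lies in some support. *)
Lemma weak_star_null_finite_supports (s : nat -> seq X) (a : nat -> X -> K) :
  (forall n, uniq (s n)) -> (forall n x, (x \in s n) = (a n x != 0)) ->
  (forall f : E,
    (\sum_(x <- s n) a n x * ev f x : K^o) @[n --> \oo] --> (0 : K^o)) ->
  finite_set [set x | exists n, x \in s n].
Proof.
move=> us sE null; apply: contrapT => infD.
have [z [U [Dz oU Uz disjU]]] := infinite_disjoint_nbhs R X tychX _ infD.
have z_inj : injective z by move=> i j zij; apply: (disjU i j (z i)) => //; rewrite zij.
have /choice[b bP] n : exists b, forall j, (b <= j)%N -> a n (z j) = 0.
  (* As [z] is injective, [xget] recovers [j] from [z j]; entries of [s n] that are no [z j]
     contribute the default 0. *)
  exists (\max_(x <- s n) xget 0%N [set j | z j = x]).+1 => j bj.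
  apply/eqP/negPn; rewrite -sE; apply/negP => zs.
  have zj : xget 0%N [set i | z i = z j] = j.
    by case: xgetP => [i _ /z_inj//|/(_ j)/=].
  have := @leq_bigmax_seq _ _ xpredT
    (fun x => xget 0%N [set i | z i = x]) _ zs isT.
  by rewrite zj leqNgt bj.
have [//|j aj] := null_finite_rows_zero_column K (fun n j => a n (z j)) b bP _.
  move=> c.
  have [f_ [f [cf ff fz fs]]] := baire_one_interpolation R X tychX K iota
    iota_continuous iota0 iota1 z U s c oU Uz disjU.
  (* Here [alpha] nonzero is used: the approximants lie in a class below [alpha]. *)
  have Bf : baire_class alpha f.
    have [beta ba] := alpha_gt0.
    apply: (@baire_class_limit _ _ _ _ alpha f (fun=> beta) f_) => // n.
    exact: baire_class_continuous.
  have sumE n : \sum_(j < b n) a n (z j) * c j = \sum_(x <- s n) a n x * f x.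
    under eq_bigr do rewrite -fz.
    rewrite -(big_mkord xpredT (fun j => a n (z j) * f (z j))) /index_iota subn0.
    rewrite -(big_map z xpredT (fun x => a n x * f x)).
    apply: big_supp => //; first by rewrite map_inj_uniq// iota_uniq.
      by move=> x _; rewrite sE negbK => /eqP ->; rewrite mul0r.
    move=> x xs xz; have [[j xj]|nz] := pselect (exists j, x = z j).
      rewrite xj bP ?mul0r// leqNgt; apply: contra xz => jb.
      by rewrite xj map_f// mem_iota.
    by rewrite (fs n) ?mulr0// => j; apply/eqP => xj; apply: nz; exists j.
  by under eq_cvg do rewrite sumE; exact: (null (exist _ f (mem_set Bf))).
have [n zs] := Dz j; by move: zs; rewrite sE aj eqxx.
Qed.

Lemma baire_space_not_JNP : ~ JNP E.
Proof.
apply=> u l ul; pose chi n : E -> K^o := \val (u n) - \val l.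
have dchi n : dual (chi n).
  by apply: dual_sub; [exact: (set_valP (u n))|exact: (set_valP l)].
have chi0 (f : E) : chi n f @[n --> \oo] --> (0 : K^o).
  rewrite -(subrr ((\val l : E -> K^o) f)).
  by apply: cvgB; [exact: (weak_star_dual_cvg _ _ u l ul f)|exact: cvg_cst].
have /choice[s /choice[a saP]] n := baire_space_dualE R X tychX K iota
  iota_continuous iota0 iota1 d W alpha (chi n) (dchi n).
have : finite_set [set x | exists n, x \in s n].
  apply: (@weak_star_null_finite_supports s a) => [n|n x|f].
  - by have [] := saP n.
  - by have [_ ->] := saP n.
  - have sumE n : \sum_(x <- s n) a n x * ev f x = chi n f.
      by have [_ _ ->] := saP n.
    by under eq_cvg do rewrite sumE; exact: chi0.
move=> /finite_seqP[t0 st0]; pose t := undup t0.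
have a_t n x : x \notin t -> a n x = 0.
  move=> xt; apply/eqP/negPn; have [_ <- _] := saP n.
  apply: contra xt => xs; rewrite mem_undup.
  suff : [set` t0] x by [].
  by rewrite -st0; exists n.
have chiE n f : chi n f = \sum_(x <- t) a n x * ev f x.
  have [us sE ->] := saP n; apply: big_supp; rewrite ?undup_uniq//.
    by move=> x _ /a_t ->; rewrite mul0r.
  by move=> x _; rewrite sE negbK => /eqP ->; rewrite mul0r.
(* Testing [chi n] on a function equal to 1 at [x] and to 0 at the rest of [t] isolates the
   coefficient. *)
have a0 x : (a n x : K^o) @[n --> \oo] --> (0 : K^o).
  have [xt|/a_t xt] := boolP (x \in t); last first.
    by under eq_cvg do rewrite xt; exact: cvg_cst.
  have [e [ce et]] := tychonoff_dual_basis R X tychX K iota iota_continuous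
    iota0 iota1 x t.
  have Be : baire_class alpha e by exact: baire_class_continuous.
  have aE n : a n x = chi n (exist _ e (mem_set Be)).
    rewrite chiE (bigD1_seq x) ?undup_uniq//= et// eqxx mulr1.
    rewrite big1_seq ?addr0// => y /andP[yx yt].
    by rewrite et// (negPf yx) mulr0.
  by under eq_cvg do rewrite aE; exact: chi0.
move=> A /nbhs_beta_star_dualP[B bB BA].
have [M BM] := barrel_bounded_eval X K d W alpha B bB.
(* This bound on [chi n] is independent of the element of [B]. *)
have : (\sum_(x <- t) `|a n x| * M x : K^o) @[n --> \oo] --> (0 : K^o).
  have {2}-> : 0 = \sum_(x <- t) 0 :> K^o by rewrite big1_eq.
  apply: (cvg_big (@add_continuous K^o)) => x _.
  rewrite -(mul0r (M x)); apply: cvgM; last exact: cvg_cst.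
  by have := cvg_norm (a0 x); rewrite normr0; apply.
move=> /cvgr0Pnorm_le/(_ _ ltr01) small.
change (\forall n \near \oo, A (u n)).
near=> n; apply: BA; split; first exact: (dchi n).
move=> f Bf; rewrite -[X in `|X|]/(chi n f) chiE.
apply: (@le_trans _ _ (\sum_(x <- t) `|a n x| * M x)); last first.
  (* Nonnegativity of [M x] comes from the element [f] of [B]. *)
  rewrite -[leLHS]ger0_norm; first by near: n.
  apply: sumr_ge0 => x _; apply: mulr_ge0 => //.
  exact: le_trans (BM x f Bf).
apply: le_trans (ler_norm_sum _ _ _) _; apply: ler_sum => x _.
by rewrite normrM ler_wpM2l// BM.
Unshelve. all: by end_near. Qed.

End baire_space_not_JNP.

(** * The real and complex cases *)

Lemma complex_of_real_continuous (R : realType) :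
  continuous ((fun r => r%:C) : R -> (R[i])^o).
Proof.
move=> r A [e /= e0 eA].
(* A positive element of [R[i]] has zero imaginary part. *)
have e_real : e = (complex.Re e)%:C.
  by apply/eqP; rewrite eq_complex/= eqxx/=; move: e0; rewrite ltcE => /andP[].
have Re_gt0 : 0 < complex.Re e by move: e0; rewrite ltcE => /andP[].
exists (complex.Re e) => // y /= ry; apply: eA.
rewrite /= e_real -rmorphB normc_def/= expr0n addr0 sqrtr_sqr.
by rewrite ltcR.
Qed.

Theorem proposition2p8 (R : realType) (X : topologicalType)
    (d : Order.disp_t) (W : orderType d) (alpha : W) :
  tychonoff_space X ->
  infinite_set [set: X] ->
  well_order (<=%O : rel W) ->
  countable [set beta : W | (beta < alpha)%O] ->
  (exists beta : W, (beta < alpha)%O) ->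
  ~ JNP (baire_space R X alpha) /\ ~ JNP (baire_space R[i] X alpha).
Proof.
move=> tychX _ _ _ alpha_gt0; split.
  by apply: (@baire_space_not_JNP R X tychX R id) => // x; exact: cvg_id.
apply: (@baire_space_not_JNP R X tychX R[i] (fun r => r%:C)) => //.
exact: complex_of_real_continuous.
Qed.
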